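(* Let $\mathcal V$ be an arbitrary variety of algebras. The following two conditions are equivalent. (i) $\mathcal V$ satisfies TImC, that is, the tolerances of algebras in $\mathcal V$ are homomorphic images of congruences of algebras in $\mathcal V$. (ii) For every $n\in\mathbb N=\{1,2,\ldots\}$, the condition $M(n)$ holds in $\mathcal V$.
   Context: A tolerance of an algebra $\mathbf A=(A;F)$ is a reflexive, symmetric relation $\tau\subseteq A^2$ compatible with all operations in $F$; congruences are exactly the transitive tolerances. If $\phi\colon\mathbf B\to\mathbf A$ is a homomorphism and $\vartheta\subseteq B^2$, write $\phi(\vartheta)=\{(\phi(a),\phi(b)):(a,b)\in\vartheta\}$. A variety $\mathcal V$ satisfies TImC (its tolerances are homomorphic images of its congruences) if for every $\mathbf A\in\mathcal V$ and every tolerance $\tau$ of $\mathbf A$ there exist an algebra $\mathbf B\in\mathcal V$, a congruence $\vartheta$ of $\mathbf B$, and a homomorphism $\phi\colon\mathbf B\to\mathbf A$ such that $\tau=\phi(\vartheta)$ (such a $\phi$ is necessarily surjective, since $\tau$ is reflexive). For $n\in\mathbb N=\{1,2,\ldots\}$, a variety $\mathcal V$ satisfies the condition $M(n)$ if for any pair $(f,g)$ of $2n$-ary terms such that the identity $$f(x_0,x_0,x_1,x_1,\ldots,x_{n-1},x_{n-1})\approx g(x_0,x_0,x_1,x_1,\ldots,x_{n-1},x_{n-1})$$ holds in $\mathcal V$, there exists a $4n$-ary term $h$ such that the identities $$f(x_0,y_0,\ldots,x_{n-1},y_{n-1})\approx h(x_0,y_0,\ldots,x_{n-1},y_{n-1},x_0,y_0,\ldots,x_{n-1},y_{n-1}),$$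 $$g(x_0,y_0,\ldots,x_{n-1},y_{n-1})\approx h(y_0,x_0,\ldots,y_{n-1},x_{n-1},x_0,y_0,\ldots,x_{n-1},y_{n-1})$$ also hold in $\mathcal V$. *)

(* Defs.v *)
From mathcomp Require Import all_boot.
From mathcomp Require Import boolp.
From Stdlib Require Import RelationClasses.

Set Implicit Arguments.
Unset Strict Implicit.
Unset Printing Implicit Defensive.

(** Algebras *)

Record signature := Signature {
  symbol : Type;
  arity : symbol -> nat }.

(* Carriers are nonempty, as usual in universal algebra; nullary symbols are
   allowed. *)
Record algebra (F : signature) := Algebra {
  carrier :> Type;
  op : forall s : symbol F, ('I_(arity s) -> carrier) -> carrier;
  nonempty : inhabited carrier }.

Arguments op {F} a s args.

Definition homomorphism (F : signature) (A B : algebra F) (phi : A -> B) : Prop :=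
  forall (s : symbol F) (a : 'I_(arity s) -> A),
    phi (op A s a) = op B s (fun i => phi (a i)).

Lemma product_nonempty (F : signature) (I : Type) (A : I -> algebra F) :
  inhabited (forall i, A i).
Proof. by constructor=> i; apply: inhabited_witness (nonempty (A i)). Qed.

Definition product (F : signature) (I : Type) (A : I -> algebra F) : algebra F :=
  @Algebra F (forall i, A i) (fun s a i => op (A i) s (fun k => a k i))
    (product_nonempty A).

(* [I] is any type, so the empty product, a one-element algebra, is included.
   An injective homomorphism into [B] is a subalgebra of [B] up to
   isomorphism. *)
Record variety (F : signature) (V : algebra F -> Prop) : Prop := Variety {
  variety_image : forall (A B : algebra F) (phi : A -> B),
    homomorphism phi -> (forall b, exists a, phi a = b) -> V A -> V B;
  variety_sub : forall (A B : algebra F) (phi : A -> B),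
    homomorphism phi -> injective phi -> V B -> V A;
  variety_product : forall (I : Type) (A : I -> algebra F),
    (forall i, V (A i)) -> V (product A) }.

(** Tolerances and congruences *)

Definition compatible (F : signature) (A : algebra F) (r : A -> A -> Prop) : Prop :=
  forall (s : symbol F) (a b : 'I_(arity s) -> A),
    (forall i, r (a i) (b i)) -> r (op A s a) (op A s b).

Definition tolerance (F : signature) (A : algebra F) (r : A -> A -> Prop) : Prop :=
  [/\ Reflexive r, Symmetric r & compatible r].

Definition congruence (F : signature) (A : algebra F) (r : A -> A -> Prop) : Prop :=
  Equivalence r /\ compatible r.

Definition image_rel (B A : Type) (phi : B -> A) (r : B -> B -> Prop) (c d : A) : Prop :=
  exists a b, [/\ r a b, phi a = c & phi b = d].

Definition TImC (F : signature) (V : algebra F -> Prop) : Prop :=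
  forall A : algebra F, V A -> forall tau : A -> A -> Prop, tolerance tau ->
  exists (B : algebra F) (theta : B -> B -> Prop) (phi : B -> A),
    [/\ V B, congruence theta, homomorphism phi &
        forall c d, tau c d <-> image_rel phi theta c d].

(** Terms and identities *)

(* A [k]-ary term is an element of [term F 'I_k]. *)
Inductive term (F : signature) (X : Type) : Type :=
| Var of X
| App (s : symbol F) of ('I_(arity s) -> term F X).

Arguments Var {F X} x.
Arguments App {F X} s args.

Fixpoint subst (F : signature) (X Y : Type) (t : term F X) (u : X -> term F Y) : term F Y :=
  match t with
  | Var x => u x
  | App s a => App s (fun i => subst (a i) u)
  end.

Fixpoint eval (F : signature) (A : algebra F) (X : Type) (v : X -> A) (t : term F X) : A :=
  match t with
  | Var x => v x
  | App s a => op A s (fun i => eval v (a i))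
  end.

Definition holds_in (F : signature) (V : algebra F -> Prop) (X : Type)
    (t u : term F X) : Prop :=
  forall A : algebra F, V A -> forall v : X -> A, eval v t = eval v u.

(** The condition M(n) *)

Lemma half_ord_proof n (k : 'I_(2 * n)) : k./2 < n.
Proof. by rewrite -divn2 ltn_divLR // [leqRHS]mulnC ltn_ord. Qed.

Definition half_ord n (k : 'I_(2 * n)) : 'I_n := Ordinal (half_ord_proof k).

(* x_0, y_0, x_1, y_1, ..., x_(n-1), y_(n-1) *)
Definition interleave (T : Type) n (x y : 'I_n -> T) (k : 'I_(2 * n)) : T :=
  if odd k then y (half_ord k) else x (half_ord k).

Definition append (T : Type) m n (u : 'I_m -> T) (v : 'I_n -> T) (k : 'I_(m + n)) : T :=
  match split k with inl i => u i | inr j => v j end.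

Definition M (F : signature) (V : algebra F -> Prop) (n : nat) : Prop :=
  forall f g : term F 'I_(2 * n),
    (let x (i : 'I_n) : term F 'I_n := Var i in
     holds_in V (subst f (interleave x x)) (subst g (interleave x x))) ->
  exists h : term F 'I_(2 * n + 2 * n),
    let x (i : 'I_n) : term F ('I_n + 'I_n) := Var (inl i) in
    let y (i : 'I_n) : term F ('I_n + 'I_n) := Var (inr i) in
    holds_in V (subst f (interleave x y))
               (subst h (append (interleave x y) (interleave x y))) /\
    holds_in V (subst g (interleave x y))
               (subst h (append (interleave y x) (interleave x y))).

(* Main.v *)
Require Import Defs.
From mathcomp Require Import all_boot.
From mathcomp Require Import boolp.

Set Implicit Arguments.
Unset Strict Implicit.
Unset Printing Implicit Defensive.

(** Both directions are computations in free algebras of [V], where equality of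
    two values is an identity of [V].

    Suppose TImC holds and [f(x,x) = g(x,x)] is an identity (writing [x] and
    [y] for tuples of length [n]).  In the free algebra on [x, y], the pairs
    [(h(x,y,x,y), h(y,x,x,y))] form the tolerance [tau] generated by the pairs
    [(x_i, y_i)]: the last [2n] arguments give reflexivity and exchanging [x]
    with [y] in the first [2n] gives symmetry.  If [tau] is the image of a
    congruence [theta], lift each [(x_i, y_i)] to a pair [(a_i, b_i)] of
    [theta]; then [f(a,b) theta f(a,a) = g(a,a) theta g(a,b)], and taking
    images, [(f(x,y), g(x,y))] is in [tau].  The term [h] witnessing this is the
    one required by [M(n)].

    Conversely, let [tau] be a tolerance of [A].  Take the free algebra [B] with
    two generators [x_p, y_p] for each pair [p] of [tau], send them to the two
    components of [p], and let [theta] be the kernel of the map from [B] to the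
    free algebra on [tau] that identifies [x_p] with [y_p].  Every pair of [tau]
    is in the image of [theta].  A pair in [theta] consists of two terms that
    agree once each [y_p] is replaced by [x_p]; these involve only finitely many
    pairs [p], so [M(n)] applies and writes their values in [A] as
    [h(a,b,a,b)] and [h(b,a,a,b)] with [a_i tau b_i].  These are related by
    [tau], which is reflexive, symmetric and compatible. *)

(** * Evaluation of terms *)

Lemma eval_subst (F : signature) (A : algebra F) (X Y : Type) (v : Y -> A)
    (t : term F X) (w : X -> term F Y) :
  eval v (subst t w) = eval (fun x => eval v (w x)) t.
Proof.
elim: t => //= s a IH; congr (op A s _); apply/funext => i; exact: IH.
Qed.

Lemma eval_homomorphism (F : signature) (A B : algebra F) (phi : A -> B)
    (X : Type) (v : X -> A) (t : term F X) :
  homomorphism phi -> phi (eval v t) = eval (fun x => phi (v x)) t.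
Proof.
move=> hphi; elim: t => //= s a IH; rewrite hphi; congr (op B s _).
by apply/funext => i; exact: IH.
Qed.

Lemma eval_compatible (F : signature) (A : algebra F) (r : A -> A -> Prop)
    (X : Type) (v w : X -> A) (t : term F X) :
  compatible r -> (forall x, r (v x) (w x)) -> r (eval v t) (eval w t).
Proof. by move=> hr vw; elim: t => //= s a IH; apply: hr. Qed.

Lemma eq_eval (F : signature) (A : algebra F) (X : Type) (v w : X -> A)
    (t : term F X) : v =1 w -> eval v t = eval w t.
Proof. by move=> /funext ->. Qed.

Fixpoint variables (F : signature) (X : Type) (t : term F X) : seq X :=
  match t with
  | Var x => [:: x]
  | App s a => flatten [seq variables (a i) | i <- enum 'I_(arity s)]
  end.

Lemma eq_in_eval (F : signature) (A : algebra F) (X : eqType) (v w : X -> A)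
    (t : term F X) : {in variables t, v =1 w} -> eval v t = eval w t.
Proof.
elim: t => [x|s a IH] /= vw; first by apply: vw; rewrite inE.
congr (op A s _); apply/funext => i; apply: IH => x xi; apply: vw.
by apply/flatten_mapP; exists i => //; rewrite mem_enum.
Qed.

Lemma holds_in_subst (F : signature) (V : algebra F -> Prop) (X Y : Type)
    (t u : term F X) (w : X -> term F Y) :
  holds_in V t u -> holds_in V (subst t w) (subst u w).
Proof. by move=> tu A VA v; rewrite !eval_subst; exact: tu. Qed.

(** * Free algebras of a variety *)

(** Freeness is expressed through identities rather than by a universal
    property; [free_extend] recovers the latter. *)
Definition free_on (F : signature) (V : algebra F -> Prop) (X : Type)
    (A : algebra F) (v : X -> A) : Prop :=
  [/\ V A, forall a, exists t, eval v t = a &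
      forall t u : term F X, eval v t = eval v u -> holds_in V t u].

Lemma generated_subalgebra (F : signature) (B : algebra F) (X : Type) (x0 : X)
    (w : X -> B) :
  exists (A : algebra F) (v : X -> A) (inc : A -> B),
    [/\ homomorphism inc, injective inc, forall x, inc (v x) = w x &
        forall a, exists t, eval v t = a].
Proof.
pose S b := exists t : term F X, eval w t = b.
have Sop s (a : 'I_(arity s) -> {b | S b}) : S (op B s (fun i => sval (a i))).
  have [t ht] := choice (fun i => svalP (a i)).
  by exists (App s t) => /=; congr (op B s _); apply/funext => i; exact: ht.
have Sw x : S (w x) by exists (Var x).
pose A := @Algebra F {b | S b} (fun s a => exist S _ (Sop s a))
  (inhabits (exist S _ (Sw x0))).
pose inc (a : A) : B := sval a.
pose v x : A := exist S _ (Sw x).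
have hinc : homomorphism inc by [].
have inj_inc : injective inc.
  move=> [b Sb] [c Sc]; rewrite /inc /= => bc; subst c.
  by congr exist; exact: Prop_irrelevance.
exists A, v, inc; split=> // a; have [t ht] := svalP a; exists t.
by apply: inj_inc; rewrite (eval_homomorphism _ _ hinc).
Qed.

(** A product of counterexamples, one for each pair of terms; a pair that is
    an identity of [V] contributes an arbitrary member of [V], such as the
    empty product. *)
Lemma separating_algebra (F : signature) (V : algebra F -> Prop) (X : Type) :
  variety V ->
  exists (P : algebra F) (w : X -> P),
    V P /\ forall t u : term F X, eval w t = eval w u -> holds_in V t u.
Proof.
move=> hV.
have sep (p : term F X * term F X) : exists Av : {A : algebra F & X -> A},
    V (projT1 Av) /\
    (eval (projT2 Av) p.1 = eval (projT2 Av) p.2 -> holds_in V p.1 p.2).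
  have [tu|/existsNP[A /not_implyP[VA /existsNP[v hv]]]] :=
    pselect (holds_in V p.1 p.2); last by exists (existT _ A v).
  pose E := product (fun e : void => of_void (algebra F) e).
  have VE : V E by apply: (variety_product hV); case.
  have e : E by case.
  by exists (existT (fun A : algebra F => X -> A) E (fun=> e)).
have [Av hAv] := choice sep.
pose P := product (fun p => projT1 (Av p)).
pose w x : P := fun p => projT2 (Av p) x.
exists P, w; split=> [|t u tu].
  by apply: (variety_product hV) => p; exact: (hAv p).1.
apply: (hAv (t, u)).2 => /=.
have hproj : homomorphism (fun q : P => q (t, u)) by [].
have /= := congr1 (fun q : P => q (t, u)) tu.
by rewrite !(eval_homomorphism _ _ hproj).
Qed.

Lemma free_exists (F : signature) (V : algebra F -> Prop) (X : Type) (x0 : X) :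
  variety V -> exists (A : algebra F) (v : X -> A), free_on V v.
Proof.
move=> hV; have [P [w [VP sep]]] := separating_algebra X hV.
have [A [v [inc [hinc inj_inc incv gen]]]] := generated_subalgebra x0 w.
exists A, v; split=> // [|t u tu].
  exact: variety_sub hV _ _ _ hinc inj_inc VP.
apply: sep; rewrite -!(eq_eval _ incv) -!(eval_homomorphism _ _ hinc).
by rewrite tu.
Qed.

Lemma free_extend (F : signature) (V : algebra F -> Prop) (X : Type)
    (A C : algebra F) (v : X -> A) (w : X -> C) :
  free_on V v -> V C ->
  exists phi : A -> C,
    homomorphism phi /\ forall t, phi (eval v t) = eval w t.
Proof.
move=> [_ gen idV] VC; have [rep repK] := choice gen.
pose phi a := eval w (rep a).
have phiE t : phi (eval v t) = eval w t by apply: idV => //; rewrite repK.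
exists phi; split=> // s a.
have -> : a = fun i => eval v (rep (a i)) by apply/funext => i; rewrite repK.
rewrite -[op A s _]/(eval v (App s (fun i => rep (a i)))) phiE /=.
by congr (op C s _); apply/funext => i; rewrite phiE.
Qed.

(** * Tuples of interleaved variables *)

Lemma position_proof n (c : bool) (i : 'I_n) : c + i.*2 < 2 * n.
Proof.
rewrite mul2n; apply: (@leq_trans i.+1.*2); last by rewrite leq_double.
by rewrite doubleS; case: c.
Qed.

(** The place of [x_i], or of [y_i] when [c] is true, in
    [x_0, y_0, x_1, y_1, ...]. *)
Definition position n (c : bool) (i : 'I_n) : 'I_(2 * n) :=
  Ordinal (position_proof c i).

Lemma interleave_position T n (x y : 'I_n -> T) c i :
  interleave x y (position c i) = if c then y i else x i.
Proof.
rewrite /interleave /= oddD odd_double addbF oddb.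
have -> // : half_ord (position c i) = i.
by apply: val_inj; rewrite /= half_bit_double.
Qed.

Lemma interleave_comp T U (phi : T -> U) n (x y : 'I_n -> T) k :
  phi (interleave x y k) = interleave (phi \o x) (phi \o y) k.
Proof. by rewrite /interleave; case: ifP. Qed.

Lemma append_comp T U (phi : T -> U) m n (u : 'I_m -> T) (v : 'I_n -> T) k :
  phi (append u v k) = append (phi \o u) (phi \o v) k.
Proof. by rewrite /append; case: split. Qed.

Lemma append_lshift T m n (u : 'I_m -> T) (v : 'I_n -> T) i :
  append u v (lshift n i) = u i.
Proof. by rewrite /append -/(unsplit (inl i)) unsplitK. Qed.

Lemma append_rshift T m n (u : 'I_m -> T) (v : 'I_n -> T) i :
  append u v (rshift m i) = v i.
Proof. by rewrite /append -/(unsplit (inr i)) unsplitK. Qed.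

Lemma eval_subst_interleave (F : signature) (A : algebra F) (Y : Type) n
    (v : Y -> A) (x y : 'I_n -> Y) (t : term F 'I_(2 * n)) :
  eval v (subst t (interleave (fun i => Var (x i)) (fun i => Var (y i)))) =
  eval (interleave (v \o x) (v \o y)) t.
Proof. by rewrite eval_subst; apply: eq_eval => k; exact: interleave_comp. Qed.

Lemma eval_subst_append (F : signature) (A : algebra F) (Y : Type) n
    (v : Y -> A) (x y z t : 'I_n -> Y) (h : term F 'I_(2 * n + 2 * n)) :
  eval v (subst h (append (interleave (fun i => Var (x i)) (fun i => Var (y i)))
                          (interleave (fun i => Var (z i)) (fun i => Var (t i)))))
  = eval (append (interleave (v \o x) (v \o y)) (interleave (v \o z) (v \o t))) h.
Proof.
rewrite eval_subst; apply: eq_eval => k; rewrite (append_comp (eval v)).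
by congr append; apply/funext => j; exact: (interleave_comp (eval v)).
Qed.

(** * From images of congruences to the terms h *)

Definition pair_tolerance (F : signature) (A : algebra F) n (x y : 'I_n -> A)
    (c d : A) : Prop :=
  exists h : term F 'I_(2 * n + 2 * n),
    c = eval (append (interleave x y) (interleave x y)) h /\
    d = eval (append (interleave y x) (interleave x y)) h.

Lemma pair_tolerance_gen (F : signature) (A : algebra F) n (x y : 'I_n -> A) i :
  pair_tolerance x y (x i) (y i).
Proof.
exists (Var (lshift _ (position false i))).
by rewrite /= !append_lshift !interleave_position.
Qed.

(** The last [2n] arguments of [h] are the same on both sides, so a term in
    them alone gives a pair [(c, c)], and every [c] arises since the [x_i, y_i]
    generate [A].  Exchanging [x_i] and [y_i] in the first [2n] arguments
    gives symmetry. *)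
Lemma pair_toleranceP (F : signature) (A : algebra F) n (x y : 'I_n -> A) :
  (forall a, exists t, eval (interleave x y) t = a) ->
  tolerance (pair_tolerance x y).
Proof.
move=> gen; split.
- move=> a; have [t <-] := gen a; exists (subst t (fun k => Var (rshift _ k))).
  by rewrite !eval_subst /=; split; apply: eq_eval => k; rewrite append_rshift.
- move=> c d [h [-> ->]].
  (* The renaming exchanges x_i and y_i among the first 2n places. *)
  pose swap : 'I_(2 * n + 2 * n) -> 'I_(2 * n + 2 * n) :=
    append (@lshift _ _ \o interleave (@position n true) (@position n false))
           (@rshift _ _).
  exists (subst h (Var \o swap)); rewrite !eval_subst.
  split; apply: eq_eval => k; rewrite /= (append_comp (append _ _));
    congr append; apply/funext => j; rewrite /= ?append_lshift ?append_rshift //;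
    rewrite (interleave_comp (interleave _ _)); congr interleave;
    by apply/funext => i; rewrite /= interleave_position.
- move=> s a b ab; have [h hh] := choice ab.
  by exists (App s h); split; congr (op A s _); apply/funext => i; case: (hh i).
Qed.

(** Transitivity of the congruence is what turns an identity between [f(x,x)]
    and [g(x,x)] into a pair [(f(x,y), g(x,y))]. *)
Lemma collapsed_identity_image (F : signature) (V : algebra F -> Prop)
    (A B : algebra F) (theta : B -> B -> Prop) (phi : B -> A) n
    (x y : 'I_n -> A) (f g : term F 'I_(2 * n)) :
  V B -> congruence theta -> homomorphism phi ->
  (forall i, image_rel phi theta (x i) (y i)) ->
  (let z (i : 'I_n) : term F 'I_n := Var i in
   holds_in V (subst f (interleave z z)) (subst g (interleave z z))) ->
  image_rel phi theta (eval (interleave x y) f) (eval (interleave x y) g).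
Proof.
move=> VB [[refl_th sym_th trans_th] comp_th] hphi /choice[a /choice[b ab]] fg.
have phi_ab t : phi (eval (interleave a b) t) = eval (interleave x y) t.
  rewrite (eval_homomorphism _ _ hphi); apply: eq_eval => k.
  rewrite (interleave_comp phi); congr interleave; apply/funext => i /=;
    by case: (ab i).
have collapse t : theta (eval (interleave a a) t) (eval (interleave a b) t).
  apply: eval_compatible => // k; rewrite /interleave; case: ifP => // _.
  by case: (ab (half_ord k)).
exists (eval (interleave a b) f), (eval (interleave a b) g); split=> //.
apply: (trans_th _ (eval (interleave a a) f)); first exact/sym_th/collapse.
have -> : eval (interleave a a) f = eval (interleave a a) g.
  by have := fg _ VB a; rewrite /= !eval_subst_interleave.
exact: collapse.
Qed.

Lemma TImC_M (F : signature) (V : algebra F -> Prop) n :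
  variety V -> 0 < n -> TImC V -> M V n.
Proof.
move=> hV n0 timc f g fg.
have [A [v [VA gen idV]]] := free_exists (inl (Ordinal n0) : 'I_n + 'I_n) hV.
pose x := v \o inl; pose y := v \o inr.
have tol : tolerance (pair_tolerance x y).
  apply: pair_toleranceP => a; have [t <-] := gen a.
  exists (subst t (fun k => Var (match k with
    | inl i => position false i | inr i => position true i end))).
  by rewrite eval_subst; apply: eq_eval => -[] i; rewrite /= interleave_position.
have [B [theta [phi [VB cong hphi tauE]]]] := timc A VA _ tol.
have xy i : image_rel phi theta (x i) (y i).
  by apply/tauE; exact: pair_tolerance_gen.
have /tauE[h [fh gh]] := collapsed_identity_image VB cong hphi xy fg.
by exists h; split; apply: idV; rewrite eval_subst_interleave eval_subst_append.
Qed.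

(** * From the terms h to images of congruences *)

Lemma tolerance_swap (F : signature) (A : algebra F) (tau : A -> A -> Prop) n
    (x y : 'I_n -> A) (h : term F 'I_(2 * n + 2 * n)) :
  tolerance tau -> (forall i, tau (x i) (y i)) ->
  tau (eval (append (interleave x y) (interleave x y)) h)
      (eval (append (interleave y x) (interleave x y)) h).
Proof.
move=> [refl_t sym_t comp_t] xy; apply: eval_compatible => // k.
rewrite /append; case: split => // j; rewrite /interleave.
by case: ifP => _ //; exact: sym_t.
Qed.

(** [M] is extended from finite to arbitrary index sets [P]: only the finitely
    many indices occurring in [t] and [u] matter, and adding [p0] to them makes
    their number positive.  The variable [(p, false)] plays the role of [x_p]
    and [(p, true)] that of [y_p]. *)
Lemma tolerance_of_collapsed (F : signature) (V : algebra F -> Prop)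
    (A : algebra F) (tau : A -> A -> Prop) (P : eqType) (p0 : P) (a b : P -> A)
    (t u : term F (P * bool)) :
  (forall n, 0 < n -> M V n) -> V A -> tolerance tau ->
  (forall p, tau (a p) (b p)) ->
  holds_in V (subst t (fun q => Var q.1)) (subst u (fun q => Var q.1)) ->
  let w (q : P * bool) := if q.2 then b q.1 else a q.1 in
  tau (eval w t) (eval w u).
Proof.
move=> hM VA tol ab tu w.
pose s := [seq q.1 | q <- variables t ++ variables u].
pose idx p : 'I_(size s).+1 := inord (index p (p0 :: s)).
pose nth_p (i : 'I_(size s).+1) := nth p0 (p0 :: s) i.
have idxK p : p \in s -> nth_p (idx p) = p.
  move=> ps; have ps' : p \in p0 :: s by rewrite inE ps orbT.
  rewrite /nth_p /idx inordK; first by rewrite nth_index.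
  by move: ps'; rewrite -index_mem.
pose rename (q : P * bool) : term F 'I_(2 * (size s).+1) :=
  Var (position q.2 (idx q.1)).
have eval_rename r (C : algebra F) (x y : 'I_(size s).+1 -> C) :
    eval (interleave x y) (subst r rename) =
    eval (fun q => if q.2 then y (idx q.1) else x (idx q.1)) r.
  by rewrite eval_subst; apply: eq_eval => q; rewrite /= interleave_position.
have [|h [th uh]] := hM _ (ltn0Sn (size s)) (subst t rename) (subst u rename).
  move=> z C VC v; rewrite /z !eval_subst_interleave !eval_rename.
  have /= := holds_in_subst (fun p => Var (idx p)) tu VC v; rewrite !eval_subst /=.
  by congr (_ = _); apply: eq_eval => q; rewrite /=; case: ifP.
pose v (k : 'I_(size s).+1 + 'I_(size s).+1) :=
  match k with inl i => a (nth_p i) | inr i => b (nth_p i) end.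
have eval_w r : {subset variables r <= variables t ++ variables u} ->
    eval w r = eval (interleave (v \o inl) (v \o inr)) (subst r rename).
  move=> rtu; rewrite eval_rename; apply: eq_in_eval => q /rtu qtu.
  by rewrite /= idxK //; exact: map_f.
rewrite !eval_w; [|by move=> q; rewrite mem_cat => ->; rewrite ?orbT ..].
have := th A VA v; rewrite eval_subst_interleave eval_subst_append => ->.
have := uh A VA v; rewrite eval_subst_interleave eval_subst_append => ->.
by apply: tolerance_swap => // i; exact: ab.
Qed.

Lemma kernel_congruence (F : signature) (A B : algebra F) (psi : A -> B) :
  homomorphism psi -> congruence (fun a b => psi a = psi b).
Proof.
move=> hpsi; split; first by split=> [a|a b|a b c] // -> .
move=> s a b ab; rewrite !hpsi; congr (op B s _); exact/funext.
Qed.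

Lemma M_TImC (F : signature) (V : algebra F -> Prop) :
  variety V -> (forall n, 0 < n -> M V n) -> TImC V.
Proof.
move=> hV hM A VA tau tol; have [refl_t _ _] := tol.
pose P := {classic {p : A * A | tau p.1 p.2}}.
have p0 : P.
  by have a := inhabited_witness (nonempty A); exists (a, a); exact: refl_t.
have [B [v freeB]] := free_exists (p0, false) hV.
have [C [z freeC]] := free_exists p0 hV.
have [VB genB _] := freeB; have [VC _ idC] := freeC.
pose a (p : P) := (sval p).1; pose b (p : P) := (sval p).2.
have [phi [hphi phiE]] :=
  free_extend (fun q : P * bool => if q.2 then b q.1 else a q.1) freeB VA.
have [psi [hpsi psiE]] := free_extend (fun q : P * bool => z q.1) freeB VC.
exists B, (fun c d => psi c = psi d), phi; split=> //.
  exact: kernel_congruence.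
move=> c d; split=> [cd|[c' [d' [psi_eq <- <-]]]].
  pose p : P := exist (fun p => tau p.1 p.2) (c, d) cd.
  exists (v (p, false)), (v (p, true)); split.
  - exact: etrans (psiE (Var (p, false))) (esym (psiE (Var (p, true)))).
  - exact: phiE (Var (p, false)).
  - exact: phiE (Var (p, true)).
move: psi_eq; have [t <-] := genB c'; have [u <-] := genB d'.
rewrite !psiE !phiE => tu; apply: (tolerance_of_collapsed p0 hM VA tol).
  by move=> p; exact: (svalP p).
by apply: idC; rewrite !eval_subst.
Qed.

Theorem theorem2p1 (F : signature) (V : algebra F -> Prop) (hV : variety V) :
  TImC V <-> (forall n : nat, 0 < n -> M V n).
Proof.
by split=> [timc n n0|]; [exact: TImC_M | exact: M_TImC].
Qed.
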